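(* Every connected graph $G$ with diameter $D$ and minor density $\delta=\delta(G)$ admits tree-restricted $8\delta D$-congestion $8\delta$-block partial shortcuts. That is, for every rooted spanning tree $T$ of $G$ of depth at most $D$ and every collection of pairwise disjoint vertex sets $P_1,\dots,P_k$ each inducing a connected subgraph of $G$, there exist an index set $I\subseteq\{1,\dots,k\}$ with $|I|\ge k/2$ and edge sets $H_i\subseteq E(T)$ for $i\in I$ such that every edge of $T$ lies in at most $8\delta D$ of the sets $H_i$, and for each $i\in I$ the graph with vertex set $P_i\cup V(H_i)$ and edge set $H_i$ has at most $8\delta$ connected components.
   Context: Minor: a graph $H=(V',E')$ is a minor of $G$ if it can be obtained from $G$ by deleting vertices/edges and contracting edges. The minor density of $G$ is $\delta(G)=\max\{|E'|/|V'| : (V',E') \text{ is a minor of } G\}$.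
   Formalization: The graph G is assumed to have at least two vertices; for the one-vertex graph D = 0 and δ = 0, and the claim fails with the single part P_1 = V(G), whose block graph has 1 > 0 components. *)

(* Defs.v *)
From HB Require Import structures.
From mathcomp Require Import all_boot all_order all_algebra.

Set Implicit Arguments.
Unset Strict Implicit.
Unset Printing Implicit Defensive.

Import Order.TTheory GRing.Theory Num.Theory.

(* A finite graph whose vertices are drawn from an ambient finite type [V].
   The vertex set is explicit so that G, its subgraphs, its spanning trees and
   its minors all live in one finite type. *)
Record graph (V : finType) := Graph {
  vertices : {set V};
  edges : {set {set V}}
}.

Definition pair_of_graph (V : finType) (G : graph V) :
  {set V} * {set {set V}} := (vertices G, edges G).

Definition graph_of_pair (V : finType) (p : {set V} * {set {set V}}) :
  graph V := Graph p.1 p.2.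

Lemma pair_of_graphK (V : finType) :
  cancel (@pair_of_graph V) (@graph_of_pair V).
Proof. by case. Qed.

HB.instance Definition _ (V : finType) :=
  Finite.copy (graph V) (can_type (@pair_of_graphK V)).

Definition simple_graph (V : finType) (G : graph V) : bool :=
  [forall e in edges G, (#|e| == 2) && (e \subset vertices G)].

Definition adj (V : finType) (G : graph V) : rel V :=
  [rel x y | [set x; y] \in edges G].

(* The graph with no vertex is not connected. *)
Definition connected_graph (V : finType) (G : graph V) : bool :=
  (vertices G != set0) &&
  [forall x in vertices G, forall y in vertices G, connect (adj G) x y].

Definition induced (V : finType) (G : graph V) (P : {set V}) : graph V :=
  Graph P [set e in edges G | e \subset P].

Definition num_components (V : finType) (G : graph V) : nat :=
  n_comp (adj G) (vertices G).

(* Least number of edges of a walk from x to y; it is #|V| (larger than every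
   actual distance) when there is no such walk. *)
Definition dist (V : finType) (G : graph V) (x y : V) : nat :=
  find (fun n => [exists p : n.-tuple V, path (adj G) x p && (last x p == y)])
       (iota 0 #|V|).

Definition diameter (V : finType) (G : graph V) : nat :=
  \max_(x in vertices G) \max_(y in vertices G) dist G x y.

Definition del_vertex (V : finType) (G : graph V) (v : V) : graph V :=
  Graph (vertices G :\ v) [set e in edges G | v \notin e].

Definition del_edge (V : finType) (G : graph V) (e : {set V}) : graph V :=
  Graph (vertices G) (edges G :\ e).

(* Contraction of the edge uv: v is renamed to u. The edge uv becomes a
   singleton and is discarded, and parallel edges are merged since the edges
   form a set: minors are again simple graphs. *)
Definition contract (V : finType) (G : graph V) (u v : V) : graph V :=
  let f x := if x == v then u else x in
  Graph (vertices G :\ v) [set f @: e | e : {set V} in edges G & #|f @: e| == 2].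

Definition minor_step (V : finType) : rel (graph V) :=
  [rel G H | [|| [exists v in vertices G, H == del_vertex G v],
                 [exists e in edges G, H == del_edge G e]
               | [exists u, exists v, adj G u v && (H == contract G u v)]]].

(* The vertex created by a contraction reuses a name from [V], so up to
   isomorphism every minor of G is a member of [graph V]. *)
Definition is_minor (V : finType) (H G : graph V) : bool :=
  connect (@minor_step V) G H.

Definition minor_density (V : finType) (G : graph V) : rat :=
  (\big[Num.max/0]_(H : graph V | is_minor H G && (vertices H != set0))
     (#|edges H|%:R / #|vertices H|%:R))%R.

Definition acyclic (V : finType) (G : graph V) : Prop :=
  forall c : seq V, ucycle (adj G) c -> size c <= 2.

Definition spanning_tree (V : finType) (G S : graph V) : Prop :=
  [/\ vertices S = vertices G, edges S \subset edges G,
      connected_graph S & acyclic S].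

Definition depth (V : finType) (S : graph V) (r : V) : nat :=
  \max_(x in vertices S) dist S r x.

Definition is_parts (V : finType) (G : graph V) (k : nat) (P : 'I_k -> {set V})
    : Prop :=
  (forall i, P i \subset vertices G /\ connected_graph (induced G (P i))) /\
  (forall i j, i != j -> [disjoint P i & P j]).

(* The vertex set V(F) of a set F of edges is [cover F]. *)
Definition block_graph (V : finType) (P : {set V}) (F : {set {set V}}) :
  graph V := Graph (P :|: cover F) F.

(* S is the tree and [I], [H] form a partial shortcut restricted to S,
   of congestion c and block number b, for the parts P. *)
Definition partial_shortcut (V : finType) (S : graph V) (k : nat)
    (P : 'I_k -> {set V}) (c b : rat)
    (I : {set 'I_k}) (H : 'I_k -> {set {set V}}) : Prop :=
  [/\ k <= 2 * #|I|,
      forall i, i \in I -> H i \subset edges S,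
      forall e, e \in edges S ->
        (#|[set i in I | e \in H i]|%:R <= c)%R
    & forall i, i \in I ->
        ((num_components (block_graph (P i) (H i)))%:R <= b)%R].

Definition admits_partial_shortcuts (V : finType) (G : graph V) (D : nat)
    (c b : rat) : Prop :=
  forall (S : graph V) (r : V),
    spanning_tree G S -> r \in vertices S -> depth S r <= D ->
  forall (k : nat) (P : 'I_k -> {set V}), is_parts G P ->
  exists (I : {set 'I_k}) (H : 'I_k -> {set {set V}}),
    partial_shortcut S P c b I H.

(* Main.v *)
Require Import Defs.
From mathcomp Require Import all_boot all_order all_algebra.
From mathcomp Require Import zify lra.

(* Let c = 8 delta D. Cut tree vertices off their parents bottom-up: a vertex v
   is cut as soon as more than c parts reach it from below without crossing an
   earlier cut; O is the set of cut vertices. Part i receives the uncut tree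
   edges that it reaches. The congestion is then at most c, and each block of
   part i contains a vertex of O, or the root, that is reached by i.
   If more than half of the parts had more than 8 delta blocks, there would be
   many pairs (v, i) with v in O reached by i. Colour the parts with 3D colours
   so that few pairs of parts meeting on a common path up to some v get the same
   colour. For each colour, contract the parts of that colour and, for each v in
   O, the vertices that reach v without meeting a part of that colour: this is a
   minor of G in which the surviving pairs (v, i) are edges. Summing over the
   3D colours the bound delta on the density of these minors contradicts the
   large number of pairs. (With 2D colours the constants match except for the
   pairs lost at the root; 3D colours leave enough room for these.) *)

Set Implicit Arguments.
Unset Strict Implicit.
Unset Printing Implicit Defensive.

Import Order.TTheory GRing.Theory Num.Theory.

(** * Adjacency and connected induced subgraphs *)

Lemma adj_sym (V : finType) (G : graph V) : symmetric (adj G).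
Proof. by move=> x y; rewrite /adj /= setUC. Qed.

Lemma adj_connect_sym (V : finType) (G : graph V) : connect_sym (adj G).
Proof. exact/sym_connect_sym/adj_sym. Qed.

Lemma adj_induced (V : finType) (G : graph V) (B : {set V}) (x y : V) :
  adj (induced G B) x y = [&& adj G x y, x \in B & y \in B].
Proof. by rewrite /adj /= inE subUset !sub1set. Qed.

Lemma connected_inducedP (V : finType) (G : graph V) (B : {set V}) :
  reflect (B != set0 /\ {in B &, forall x y, connect (adj (induced G B)) x y})
          (connected_graph (induced G B)).
Proof.
apply: (iffP andP) => -[Bn0 Bc]; split=> //.
  by move=> x y xB yB; exact: (forall_inP (forall_inP Bc x xB) y yB).
by apply/forall_inP=> x xB; apply/forall_inP=> y yB; apply: Bc.
Qed.

Lemma connect_homo (V W : finType) (e : rel V) (e' : rel W) (f : V -> W) :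
  {homo f : x y / e x y >-> connect e' x y} ->
  {homo f : x y / connect e x y >-> connect e' x y}.
Proof.
move=> fP x _ /connectP[p exp ->]; elim: p x exp => [|y p IHp] x //=.
by case/andP=> /fP fxy /IHp; apply: connect_trans.
Qed.

(** A path in [B] maps to a path once the edges with identified ends are dropped. Vertex deletion
    uses this with [f] the identity, edge contraction with the renaming map. *)
Lemma connected_induced_homo (V : finType) (G G' : graph V) (B : {set V})
    (f : V -> V) :
  connected_graph (induced G B) ->
  {in B &, forall x y, adj G x y -> f x != f y -> adj G' (f x) (f y)} ->
  connected_graph (induced G' (f @: B)).
Proof.
case/connected_inducedP=> /set0Pn[b bB] Bc fP; apply/connected_inducedP; split.
  by apply/set0Pn; exists (f b); apply: imset_f.
move=> _ _ /imsetP[x xB ->] /imsetP[y yB ->].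
apply: connect_homo (Bc x y xB yB) => u v; rewrite adj_induced => /and3P[auv uB vB].
have [->|nfuv] := eqVneq (f u) (f v); first exact: connect0.
by apply: connect1; rewrite adj_induced fP ?imset_f.
Qed.

Lemma connected_edge (V : finType) (G : graph V) (B : {set V}) :
  connected_graph (induced G B) -> 1 < #|B| ->
  exists x y, [/\ x \in B, y \in B, x != y & adj G x y].
Proof.
case/connected_inducedP=> _ Bc /card_gt1P[x [y [xB yB nxy]]].
case/connectP: (Bc x y xB yB) => p xp def_y.
case/shortenP: xp def_y => -[|z q] /= xq xuq _ def_y; first by rewrite def_y eqxx in nxy.
case/andP: xq; rewrite adj_induced => /and3P[axz _ zB] _; exists x, z; split=> //.
by apply: contraTneq xuq => ->; rewrite inE eqxx.
Qed.

(** * Minors from disjoint connected branch sets *)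

Lemma adj_contract (V : finType) (G : graph V) (u v x y : V)
    (f := fun w => if w == v then u else w) :
  adj G x y -> f x != f y -> adj (contract G u v) (f x) (f y).
Proof.
rewrite /adj /= => axy nfxy; apply/imsetP; exists [set x; y].
  by rewrite inE axy imsetU1 imset_set1 cards2 nfxy.
by rewrite imsetU1 imset_set1.
Qed.

(* [A] contains at most one orientation of each pair of branch sets, so that
   [#|A|] counts adjacent pairs. *)
Lemma minor_of_branch_sets (V J : finType) (G : graph V) (B : J -> {set V})
    (J0 : {set J}) (A : {set J * J}) :
  {in J0, forall j, B j \subset vertices G /\ connected_graph (induced G (B j))} ->
  {in J0 &, forall i j, i != j -> [disjoint B i & B j]} ->
  {in A, forall a, [/\ a.1 \in J0, a.2 \in J0, (a.2, a.1) \notin A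
     & exists x y, [/\ x \in B a.1, y \in B a.2 & adj G x y]]} ->
  exists H, [/\ is_minor H G, #|vertices H| = #|J0| & #|A| <= #|edges H|].
Proof.
(* Induction on the number of vertices: delete a vertex outside all branch sets, or contract an edge
   inside one, until the branch sets are exactly the singletons of vertices of [G]. *)
move: {2}(#|vertices G|) (leqnn #|vertices G|) => n.
elim: n G B => [|n IHn] G B leGn Bc Bdis AP.
all: have Bn0 j : j \in J0 -> B j != set0
  by move=> jJ; case: (Bc j jJ) => _ /connected_inducedP[].
- exists G; split; first exact: connect0.
    move: leGn; rewrite leqn0 cards_eq0 => /eqP G0; rewrite G0 cards0.
    suff /eqP->: J0 == set0 by rewrite cards0.
    rewrite -subset0; apply/subsetP=> j jJ; case/negP: (Bn0 _ jJ).
    by rewrite -subset0 -G0; case: (Bc j jJ).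
  rewrite (_ : A = set0) ?cards0 //; apply/eqP; rewrite -subset0; apply/subsetP=> a.
  case/AP=> aJ _ _ _; case/negP: (Bn0 _ aJ); rewrite -subset0.
  by move: leGn; rewrite leqn0 cards_eq0 => /eqP <-; case: (Bc _ aJ).
have minor_trans G' H : minor_step G G' -> is_minor H G' -> is_minor H G.
  by move=> GG'; apply/connect_trans/connect1.
have [/exists_inP[v vG /forall_inP vB]|allB] :=
  boolP [exists v in vertices G, [forall j in J0, v \notin B j]].
  have sub_adj j x y : j \in J0 -> x \in B j -> y != v -> adj G x y ->
      adj (del_vertex G v) x y.
    move=> jJ xB nyv axy; rewrite /adj /= inE [_ \in edges G]axy !inE negb_or.
    rewrite eq_sym [v == y]eq_sym nyv andbT.
    by apply: contraNneq (vB j jJ) => <-.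
  have nBv j y : j \in J0 -> y \in B j -> y != v.
    by move=> jJ yB; apply: contraNneq (vB j jJ) => <-.
  case: (IHn (del_vertex G v) B).
  - by move: leGn; rewrite (cardsD1 v) vG.
  - move=> j jJ; have [Bj cBj] := Bc j jJ; split.
      rewrite subsetD1 Bj /=; exact: vB.
    rewrite -[B j]imset_id; apply: (connected_induced_homo cBj) => x y xB yB axy _.
    by apply: (sub_adj j) => //; apply: (nBv j).
  - exact: Bdis.
  - move=> a aA; have [a1 a2 a21 [x [y [xB yB axy]]]] := AP a aA; split=> //.
    by exists x, y; split=> //; apply: (sub_adj a.1) => //; apply: (nBv a.2).
  move=> H [HG' cH eH]; exists H; split=> //; apply: minor_trans HG' => /=.
  by apply/or3P; constructor 1; apply/exists_inP; exists v.
have [/exists_inP[j jJ Bj1]|allB1] := boolP [exists j in J0, 1 < #|B j|].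
  have [u [v [uB vB nuv auv]]] := connected_edge (proj2 (Bc j jJ)) Bj1.
  pose f w := if w == v then u else w.
  (* Among the branch sets only [B j] contains [v], and it also contains [u]; so the renaming keeps
     each branch set inside itself. *)
  have fB i w : i \in J0 -> w \in B i -> f w \in B i.
    move=> iJ wB; rewrite /f; case: eqP => // wv; rewrite {}wv in wB.
    have [-> //|nij] := eqVneq i j.
    by case/negP: (disjointFr (Bdis _ _ iJ jJ nij) wB).
  have fBS i : i \in J0 -> f @: B i \subset B i.
    by move=> iJ; apply/subsetP=> _ /imsetP[w wB ->]; apply: fB.
  case: (IHn (contract G u v) (fun i => f @: B i)).
  - move: leGn; rewrite (cardsD1 v) (subsetP (proj1 (Bc j jJ))) //.
  - move=> i iJ; have [Bi cBi] := Bc i iJ; split.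
      rewrite subsetD1 (subset_trans (fBS i iJ)) //=.
      apply/imsetP=> -[w _]; rewrite /f; case: eqP => [_ vu|nwv wv].
        by rewrite vu eqxx in nuv.
      by rewrite wv in nwv.
    by apply: (connected_induced_homo cBi) => x y _ _; apply: adj_contract.
  - move=> i i' iJ i'J nii'; apply: disjointWl (fBS i iJ) _.
    by apply: disjointWr (fBS i' i'J) _; apply: Bdis.
  - move=> a aA; have [a1 a2 a21 [x [y [xB yB axy]]]] := AP a aA; split=> //.
    exists (f x), (f y); rewrite !imset_f //; split=> //; apply: adj_contract => //.
    have na12 : a.1 != a.2.
      by apply: contraNneq a21 => e12; rewrite -e12 {2}e12 -surjective_pairing.
    apply/eqP=> fxy; move: (disjointFr (Bdis _ _ a1 a2 na12) (fB _ _ a1 xB)).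
    by rewrite [f x]fxy fB.
  move=> H [HG' cH eH]; exists H; split=> //; apply: minor_trans HG' => /=.
  apply/or3P; constructor 3; apply/existsP; exists u; apply/existsP; exists v.
  by rewrite auv eqxx.
have B1 j : j \in J0 -> exists x, B j = [set x].
  move=> jJ; apply/cards1P; rewrite eqn_leq card_gt0 Bn0 // andbT leqNgt.
  by apply: contra allB1 => Bj1; apply/exists_inP; exists j.
have eqJ i j x : i \in J0 -> j \in J0 -> x \in B i -> x \in B j -> i = j.
  move=> iJ jJ xi xj; apply/eqP; apply: contraTT xj => nij.
  by rewrite (disjointFr (Bdis _ _ iJ jJ nij) xi).
exists G; split; first exact: connect0.
  rewrite -(card_imset _ (@set1_inj V)) -[RHS](card_in_imset (f := B)).
    apply: eq_card => X; apply/imsetP/imsetP=> [[x xG ->]|[j jJ ->]].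
      have: [exists j in J0, x \in B j].
        apply: contraR allB; rewrite negb_exists_in => nB.
        by apply/exists_inP; exists x.
      case/exists_inP=> j jJ xB; exists j => //; have [y def_B] := B1 j jJ.
      by move: xB; rewrite def_B inE => /eqP->.
    have [x def_B] := B1 j jJ; exists x => //.
    by apply: (subsetP (proj1 (Bc j jJ))); rewrite def_B inE.
  move=> i j iJ jJ eB; have [x def_B] := B1 i iJ.
  by apply: (eqJ i j x) => //; rewrite -?eB def_B inE.
(* Each pair of [A] gives the edge formed by its two singletons; as [A] never holds both
   orientations, this is injective. *)
rewrite -(card_in_imset (f := fun a : J * J => B a.1 :|: B a.2) (D := A)).
  apply: subset_leq_card; apply/subsetP=> _ /imsetP[a aA ->].
  have [a1 a2 _ [x [y [xB yB axy]]]] := AP a aA.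
  have [x' def1] := B1 _ a1; have [y' def2] := B1 _ a2.
  by move: xB yB; rewrite def1 def2 !inE => /eqP <- /eqP <-.
move=> a b aA bA /= eab.
have [a1 a2 a21 _] := AP a aA; have [b1 b2 b21 _] := AP b bA.
have half i : i \in J0 -> B i \subset B b.1 :|: B b.2 -> i = b.1 \/ i = b.2.
  move=> iJ; have [x def_B] := B1 i iJ; rewrite def_B sub1set inE.
  by case/orP=> xb; [left|right]; apply: (eqJ _ _ x) => //; rewrite def_B inE.
have [ba1 bb1] : (a.1 = b.1 \/ a.1 = b.2) /\ (a.2 = b.1 \/ a.2 = b.2).
  by split; apply: half; rewrite // -eab ?subsetUl ?subsetUr.
rewrite (surjective_pairing a) in aA *; rewrite (surjective_pairing b) in bA *.
by case: ba1 bb1 => e1 [] e2; rewrite e1 e2 ?bA // in aA a21 *; rewrite aA in a21.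
Qed.

Lemma branch_sets_density (V J : finType) (G : graph V) (B : J -> {set V})
    (J0 : {set J}) (A : {set J * J}) :
  {in J0, forall j, B j \subset vertices G /\ connected_graph (induced G (B j))} ->
  {in J0 &, forall i j, i != j -> [disjoint B i & B j]} ->
  {in A, forall a, [/\ a.1 \in J0, a.2 \in J0, (a.2, a.1) \notin A
     & exists x y, [/\ x \in B a.1, y \in B a.2 & adj G x y]]} ->
  (#|A|%:R <= minor_density G * #|J0|%:R)%R.
Proof.
move=> Bc Bdis AP; have [H [HG cH eH]] := minor_of_branch_sets Bc Bdis AP.
(* An empty [J0] gives a minor without vertices, which the maximum excludes; but then [A] is empty
   too. *)
have [J00|] := posnP #|J0|.
  suff /eqP->: A == set0 by rewrite cards0 J00 mulr0.
  rewrite -subset0; apply/subsetP=> a /AP[aJ _ _ _].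
  by move/eqP: J00; rewrite cards_eq0 => /eqP J00; rewrite J00 inE in aJ.
rewrite -cH => H_gt0; rewrite -ler_pdivrMr ?ltr0n //.
apply: (@le_trans _ _ (#|edges H|%:R / #|vertices H|%:R)%R).
  by rewrite ler_pM2r ?invr_gt0 ?ltr0n // ler_nat.
by apply: le_bigmax_cond; rewrite HG -card_gt0.
Qed.

(** * Colourings with few monochromatic pairs *)

Lemma card_monochromatic (K C : finType) (i j : K) :
  i != j ->
  #|C| * #|[set f : {ffun K -> C} | f i == f j]| <= #|{ffun K -> C}|.
Proof.
move=> nij; rewrite mulnC -cardsT -cardsX.
(* Recolouring [i] arbitrarily is injective on the colourings with [f i = f j]: the new colour is
   read off at [i], the old one at [j]. *)
pose recolor (u : {ffun K -> C} * C) := [ffun l => if l == i then u.2 else u.1 l].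
rewrite -(card_in_imset (f := recolor)) ?max_card // => -[f c] [g d] /=.
rewrite !inE !andbT => /eqP fij /eqP gij /ffunP e.
have ecd: c = d by move: (e i); rewrite !ffunE eqxx.
congr (_, _) => //; apply/ffunP=> l; move: (e l); rewrite !ffunE /=.
have [->|//] := eqVneq l i; move=> _; rewrite fij gij.
by move: (e j); rewrite !ffunE eq_sym (negPf nij).
Qed.

(* The average over all colourings makes a [1 / #|C|] fraction of the pairs
   monochromatic. *)
Lemma few_monochromatic (T K C : finType) (A : {set T}) (a b : T -> K) :
  0 < #|C| -> {in A, forall t, a t != b t} ->
  exists f : {ffun K -> C},
    #|C| * #|[set t in A | f (a t) == f (b t)]| <= #|A|.
Proof.
move=> C_gt0 nab; apply/existsP; apply: contraT; rewrite negb_exists => /forallP badf.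
have /card_gt0P[c _] := C_gt0.
pose mono f := #|[set t in A | (f : {ffun K -> C}) (a t) == f (b t)]|.
have lo: #|{ffun K -> C}| * #|A|.+1 <= \sum_f #|C| * mono f.
  by rewrite -sum_nat_const; apply: leq_sum => f _; rewrite ltnNge badf.
have hi: \sum_f #|C| * mono f <= #|A| * #|{ffun K -> C}|.
  rewrite -big_distrr /=.
  under eq_bigr => f _ do rewrite /mono -sum1dep_card big_mkcondr.
  rewrite exchange_big big_distrr /= -sum_nat_const.
  apply: leq_sum => t tA; apply: leq_trans (card_monochromatic C (nab t tA)).
  by rewrite -big_mkcond sum1dep_card.
have: 0 < #|{ffun K -> C}| by apply/card_gt0P; exists [ffun=> c].
by move=> F_gt0; move: (leq_trans lo hi); rewrite mulnC leq_pmul2r // ltnn.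
Qed.

(** * Components, distances and breadth-first parents *)

Lemma num_components_leq (V : finType) (G : graph V) (A : {set V}) :
  {in vertices G, forall x, exists2 t, t \in A & connect (adj G) x t} ->
  num_components G <= #|A|.
Proof.
(* Every component representative is the representative of some element of [A]. *)
move=> topP; apply: leq_trans (leq_imset_card (fingraph.root (adj G)) A).
apply/subset_leq_card/subsetP=> x; rewrite !inE => /andP[/eqP rx xG].
have [t tA xt] := topP x xG; apply/imsetP; exists t => //.
by rewrite -[LHS]rx; apply/eqP; rewrite root_connect //; apply: adj_connect_sym.
Qed.

Lemma leq_dist (V : finType) (G : graph V) (x : V) (p : seq V) :
  path (adj G) x p -> dist G x (last x p) <= size p.
Proof.
move=> xp; rewrite leqNgt; apply/negP=> lt_pd.
have := before_find 0 lt_pd; rewrite nth_iota ?add0n; last first.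
  by apply: leq_trans lt_pd _; rewrite -[leqRHS](size_iota 0); apply: find_size.
by move/existsP; apply; exists (in_tuple p); rewrite xp /=.
Qed.

(** A shortened walk has fewer than [#|V|] edges, so the search in [dist] succeeds and its default
    [#|V|] is not returned. *)
Lemma dist_walk (V : finType) (G : graph V) (x y : V) :
  connect (adj G) x y ->
  exists p, [/\ path (adj G) x p, last x p = y & size p = dist G x y].
Proof.
case/connectP=> p xp ->; case/shortenP: xp => q xq /card_uniqP uq _.
pose a n := [exists p : n.-tuple V, path (adj G) x p && (last x p == last x q)].
have has_a: has a (iota 0 #|V|).
  apply/hasP; exists (size q); last first.
    by apply/existsP; exists (in_tuple q); rewrite xq /=.
  by rewrite mem_iota /= add0n -[(size q).+1]uq max_card.
have find_lt : find a (iota 0 #|V|) < #|V|.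
  by rewrite -[ltnRHS](size_iota 0) -has_find.
have := nth_find 0 has_a; rewrite nth_iota // add0n.
by case/existsP=> t /andP[xt /eqP tq]; exists t; rewrite size_tuple.
Qed.

(* Acyclicity of the tree plays no role: a breadth-first spanning tree of it
   suffices. *)
Lemma bfs_parents (V : finType) (S : graph V) (r : V) :
  connected_graph S -> r \in vertices S ->
  {in edges S, forall e : {set V}, e \subset vertices S} ->
  exists (par : V -> V) (d : V -> nat),
   [/\ d r = 0,
       {in vertices S, forall x, d x <= depth S r},
       forall x, d (par x) = (d x).-1,
       {in vertices S, forall x, par x \in vertices S} &
       {in vertices S, forall x, x != r -> 0 < d x /\ adj S x (par x)}].
Proof.
move=> Sc rS Se.
have cr x : x \in vertices S -> connect (adj S) r x.
  by move=> xS; case/andP: Sc => _ /forall_inP/(_ r rS)/forall_inP; apply.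
have parP x : x \in vertices S -> x != r -> exists y,
    [&& adj S x y, y \in vertices S & dist S r x == (dist S r y).+1].
  (* The penultimate vertex of a shortest walk from [r] to [x] is one step closer to [r]. *)
  move=> xS nxr; have [p [rp lp sp]] := dist_walk (cr x xS).
  case/lastP: p => [|p z] in rp lp sp *; first by rewrite -lp eqxx in nxr.
  move: rp lp sp; rewrite rcons_path last_rcons size_rcons => /andP[rp az] zx sp.
  rewrite {z}zx in az; have yS: last r p \in vertices S.
    by apply: (subsetP (Se _ az)); rewrite !inE eqxx.
  have [q [rq lq sq]] := dist_walk (cr _ yS).
  exists (last r p); rewrite adj_sym az yS eqn_leq -{2}sp ltnS leq_dist //= andbT -sq.
  have: path (adj S) r (rcons q x) by rewrite rcons_path rq lq.
  by move/leq_dist; rewrite last_rcons size_rcons.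
pose up x := [pick y | [&& adj S x y, y \in vertices S & dist S r x == (dist S r y).+1]].
(* At [r] and outside [S], [par] is the identity and [d] is 0, so [d (par x) = (d x).-1] holds for
   every [x] by truncation. *)
pose par x := if (x \in vertices S) && (x != r) then odflt x (up x) else x.
pose d x := if x \in vertices S then dist S r x else 0.
have dr: d r = 0 by rewrite /d rS; apply/eqP; rewrite -leqn0 (@leq_dist _ _ _ [::]).
have parE x : x \in vertices S -> x != r ->
    [/\ adj S x (par x), par x \in vertices S & d x = (d (par x)).+1].
  move=> xS nxr; rewrite /par /up xS nxr /=; case: pickP => [y|no_y].
    by case/and3P=> axy yS /eqP dy /=; rewrite /d xS yS.
  by have [y] := parP x xS nxr; rewrite no_y.
have par_root x : ~~ ((x \in vertices S) && (x != r)) -> par x = x.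
  by rewrite /par => /negPf->.
exists par, d; split=> //.
- by move=> x xS; rewrite /d xS; apply: (leq_bigmax_cond (F := dist S r)).
- move=> x; have [/andP[xS nxr]|nx] := boolP ((x \in vertices S) && (x != r)).
    by have [_ _ ->] := parE x xS nxr.
  rewrite par_root //; move: nx; rewrite negb_and negbK => /orP[nxS|/eqP->].
    by rewrite /d (negPf nxS).
  by rewrite dr.
- move=> x xS; have [->|nxr] := eqVneq x r; first by rewrite par_root ?eqxx ?andbF.
  by have [] := parE x xS nxr.
by move=> x xS nxr; have [? _ ->] := parE x xS nxr.
Qed.

(** * Reachability in the cut forest *)

Section Reach.

Variables (V : finType) (par : V -> V) (d : V -> nat).
Hypothesis d_par : forall x, d (par x) = (d x).-1.
Implicit Types (O U : {set V}) (v w x y : V).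

(* In the forest left after cutting every vertex of [O] off its parent, [x]
   lies below [v]. *)
Definition reach (O : {set V}) (v x : V) : bool :=
  (iter (d x - d v) par x == v) &&
  [forall a : 'I_(d x - d v), iter a par x \notin O].

Definition reaching (K : finType) (P : K -> {set V}) (O : {set V}) (v : V) :
  {set K} := [set i | [exists x in P i, reach O v x]].

Lemma d_iter a x : d (iter a par x) = d x - a.
Proof. by elim: a => [|a IHa]; rewrite ?subn0 // iterS d_par IHa subnS. Qed.

(** Otherwise each vertex would be the parent of the other, which the depths forbid. A tree edge is
    thus identified by its lower end. *)
Lemma parent_edge_inj x y :
  0 < d x -> 0 < d y -> [set x; par x] = [set y; par y] -> x = y.
Proof.
move=> dx dy exy.
have /set2P[//|xpy] : x \in [set y; par y] by rewrite -exy set21.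
have /set2P[//|ypx] : y \in [set x; par x] by rewrite exy set21.
by have := d_par x; have := d_par y; rewrite -xpy -ypx; lia.
Qed.

(** Going up [m <= d x] steps lowers the depth by exactly [m], so [m] can only be [d x - d v]. *)
Lemma reachP O v x :
  reflect (exists m, [/\ m <= d x, iter m par x = v &
                         forall a, a < m -> iter a par x \notin O])
          (reach O v x).
Proof.
apply: (iffP andP) => [[/eqP xv /forallP xO]|[m [le_m xv xO]]].
  exists (d x - d v); split=> // [|a lt_a]; first exact: leq_subr.
  exact: (xO (Ordinal lt_a)).
have def_m : d x - d v = m by rewrite -xv d_iter subKn.
split; first by rewrite def_m xv.
by apply/forallP=> a; apply: xO; rewrite -def_m.
Qed.

Lemma reach_refl O v : reach O v v.
Proof. by apply/reachP; exists 0; split. Qed.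

Lemma reach_iter O v x : reach O v x -> iter (d x - d v) par x = v.
Proof. by case/andP=> /eqP. Qed.

Lemma reach_par O v x : reach O v x -> v \notin O -> 0 < d v -> reach O (par v) x.
Proof.
case/reachP=> m [le_m <- xO] vO; rewrite d_iter subn_gt0 => lt_m.
apply/reachP; exists m.+1; split=> // a; rewrite ltnS leq_eqVlt => /predU1P[->//|].
exact: xO.
Qed.

(** Both are the first vertex of [O] met on the way up from [x]. *)
Lemma reach_inj O v w x :
  v \in O -> w \in O -> reach O v x -> reach O w x -> v = w.
Proof.
move=> vO wO /reachP[m [_ xv xO]] /reachP[n [_ xw xO']].
case: (ltngtP m n) => [/xO'|/xO|mn]; rewrite ?xv ?xw ?vO ?wO //.
by rewrite -xv mn.
Qed.

Lemma reach_step O v x : reach O v x -> x != v ->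
  [/\ 0 < d x, x \notin O & reach O v (par x)].
Proof.
case/reachP=> -[[_ /= -> _ /eqP//]|m [lt_m xv xO] _]; split; [lia | exact: (xO 0)|].
apply/reachP; exists m; rewrite d_par -iterSr; split=> // [|a lt_a]; first lia.
by rewrite -iterSr; apply: xO.
Qed.

Lemma reach_setU O U v x : reach O v x ->
  (forall a, a < d x - d v -> iter a par x \notin U) -> reach (O :|: U) v x.
Proof.
case/andP=> xv /forallP xO xU; apply/andP; split=> //.
by apply/forallP=> a; rewrite inE negb_or xO xU.
Qed.

(** The vertices tested on the way from [x] to [v] are all strictly deeper than [v]. *)
Lemma eq_reach O O' v x :
  (forall y, d v < d y -> (y \in O) = (y \in O')) -> reach O v x = reach O' v x.
Proof.
move=> eqO; rewrite /reach; congr (_ && _); apply: eq_forallb => a.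
by rewrite eqO // d_iter; have := ltn_ord a; lia.
Qed.

Lemma eq_reaching (K : finType) (P : K -> {set V}) O O' v :
  (forall y, d v < d y -> (y \in O) = (y \in O')) ->
  reaching P O v = reaching P O' v.
Proof.
move=> eqO; apply/setP=> i; rewrite !inE; apply: eq_existsb => x.
by rewrite (eq_reach _ eqO).
Qed.

(* Whether [v] is cut depends only on the cuts strictly below it, so the cuts
   are decided bottom-up. *)
Lemma cut_set (K : finType) (P : K -> {set V}) (over : pred {set K}) :
  exists O : {set V}, forall v, (v \in O) = over (reaching P O v).
Proof.
pose N := \max_v d v.
(* After [n] rounds the cuts are right at all depths greater than [N - n]; the next round decides
   depth [N - n]. *)
suff /(_ N.+1)[O OP]: forall n, exists O : {set V}, forall v, N < d v + n ->
    (v \in O) = over (reaching P O v).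
  by exists O => v; apply: OP; rewrite addnS ltnS leq_addl.
elim=> [|n [O OP]].
  by exists set0 => v; rewrite addn0 ltnNge (leq_bigmax v).
exists [set v | if d v + n == N then over (reaching P O v) else v \in O] => v lt_v.
rewrite inE (@eq_reaching _ _ _ O) => [|y lt_y].
  by case: ifPn => // nN; apply: OP; lia.
by rewrite inE; case: ifPn => // /eqP; lia.
Qed.

(* The last vertex of the part [P i] on the way up to [v]. *)
Definition exit (K : finType) (P : K -> {set V}) (O : {set V}) (p : V * K) : V :=
  odflt p.1 [pick x | [&& x \in P p.2, reach O p.1 x &
    [forall a : 'I_(d x - d p.1), iter a.+1 par x \notin P p.2]]].

Lemma exitP (K : finType) (P : K -> {set V}) (O : {set V}) v i :
  i \in reaching P O v ->
  let x := exit P O (v, i) in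
  [/\ x \in P i, reach O v x &
      forall a, 0 < a <= d x - d v -> iter a par x \notin P i].
Proof.
rewrite inE => /exists_inP[x xP xv]; rewrite /exit /=.
case: pickP => [y /and3P[yP yv /forallP yQ]|no_x] /=.
  split=> // -[//|a] /= lt_a; exact: (yQ (Ordinal lt_a)).
(* Without an exit vertex, each vertex of [P i] reaching [v] would have another one properly above
   it: an infinite descent in [d]. *)
have [n le_n] := ubnP (d x); elim: n => // n IHn in x xP xv le_n *.
have := no_x x; rewrite xP xv /= => /negbT/forallPn[a]; rewrite negbK.
move: (ltn_ord a); move: (nat_of_ord a) => {}a lt_a aP.
apply: (IHn (iter a.+1 par x)) => //; last by rewrite d_iter; lia.
case/reachP: xv lt_a aP => m [le_m <- xO]; rewrite d_iter subKn // => lt_a aP.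
apply/reachP; exists (m - a.+1); rewrite d_iter -iterD subnK //; split=> // [|b lt_b].
  lia.
by rewrite -iterD; apply: xO; lia.
Qed.

End Reach.

(** * Counting by fibres *)

Lemma card_fibers (T C : finType) (A : {set T}) (g : T -> C) :
  #|A| = \sum_c #|[set x in A | g x == c]|.
Proof.
rewrite -sum1_card (partition_big g xpredT) //; apply: eq_bigr => c _.
by rewrite sum1dep_card.
Qed.

Lemma card_dep_pairs (T C : finType) (A : {set T}) (B : T -> {set C}) :
  #|[set p | (p.1 \in A) && (p.2 \in B p.1)]| = \sum_(x in A) #|B x|.
Proof.
rewrite -sum1dep_card -(pair_big_dep _ (fun x c => c \in B x) (fun _ _ => 1)) /=.
by apply: eq_bigr => x _; rewrite sum1_card.
Qed.

(** * Upper bound on the crossings by the minor density *)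

Section Crossings.

Variables (V K : finType) (G : graph V) (par : V -> V) (d : V -> nat) (D : nat).
Variables (P : K -> {set V}) (O : {set V}).

Hypothesis d_par : forall x, d (par x) = (d x).-1.
Hypothesis d_leq : {in vertices G, forall x, d x <= D}.
Hypothesis par_vertex : {in vertices G, forall x, par x \in vertices G}.
Hypothesis adj_par : {in vertices G, forall x, 0 < d x -> adj G x (par x)}.
Hypothesis P_connected :
  forall i, P i \subset vertices G /\ connected_graph (induced G (P i)).
Hypothesis P_disjoint : forall i j, i != j -> [disjoint P i & P j].
Hypothesis O_vertices : O \subset vertices G.

Let part_inj i j x : x \in P i -> x \in P j -> i = j.
Proof.
move=> xi xj; apply/eqP; apply: contraTT xj => nij.
by rewrite (disjointFr (P_disjoint nij) xi).
Qed.

(** The branch set of [v], used with [Q] the cuts plus a union of parts. Membership of [v] itself in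
    [Q] is not tested. *)
Definition basin (Q : {set V}) (v : V) : {set V} :=
  [set y in vertices G | reach par d Q v y].

Lemma basin_connected Q v :
  v \in vertices G -> connected_graph (induced G (basin Q v)).
Proof.
move=> vG; have vB: v \in basin Q v by rewrite inE vG (reach_refl d_par).
suff to_v y : y \in basin Q v -> connect (adj (induced G (basin Q v))) y v.
  apply/connected_inducedP; split=> [|x y xB yB]; first by apply/set0Pn; exists v.
  apply: connect_trans (to_v x xB) _; rewrite adj_connect_sym; exact: to_v.
have [n le_n] := ubnP (d y); elim: n => // n IHn in y le_n *.
move=> yB; have := yB; rewrite inE => /andP[yG yv].
have [->|nyv] := eqVneq y v; first exact: connect0.
have [dy yQ pyv] := reach_step d_par yv nyv.
have pyB: par y \in basin Q v by rewrite inE par_vertex.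
apply: connect_trans (IHn _ _ pyB); last by rewrite d_par -ltnS prednK.
by apply: connect1; rewrite adj_induced adj_par ?yB.
Qed.

Definition crossings : {set V * K} :=
  [set p | p.1 \in O & p.2 \in reaching par d P O p.1].

Let outer := [set p in crossings | p.1 \notin P p.2].

(* The other parts met on the way from the exit vertex of [p.2] to [p.1]. *)
Let between (p : V * K) : {set K} := let x := exit par d P O p in
  [set j | [exists a : 'I_(d x - d p.1), iter a.+1 par x \in P j]].

Let outerP p : p \in outer -> let x := exit par d P O p in
  [/\ p.1 \in O, p.1 \notin P p.2, x \in P p.2, reach par d O p.1 x & p.2 \notin between p].
Proof.
case: p => v i; rewrite !inE /= -andbA => /and3P[vO iv nvP].
have [|xP xv xQ] := @exitP _ par d d_par _ P O v i; first by rewrite inE.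
split=> //; apply/existsP=> -[a]; apply/negP.
by apply: (xQ a.+1); rewrite ltn_ord.
Qed.

(** The way from the exit vertex to [p.1] has at most [D] steps, and by disjointness each step
    enters at most one part. *)
Let card_between p : p \in outer -> #|between p| <= D.
Proof.
move=> pX; have [_ _ xP _ _] := outerP pX; set x := exit _ _ _ _ _ in xP.
have le_m : d x - d p.1 <= D.
  by apply: leq_trans (leq_subr _ _) (d_leq _); apply: (subsetP (proj1 (P_connected p.2))).
apply: leq_trans le_m; rewrite -[leqRHS]card_ord.
pose g j : option 'I_(d x - d p.1) := [pick a : 'I_(d x - d p.1) | iter a.+1 par x \in P j].
rewrite -[leqRHS](card_imset _ (@Some_inj _)) -(card_in_imset (f := g)).
  apply/subset_leq_card/subsetP=> _ /imsetP[j jB ->]; rewrite /g.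
  case: pickP => [a _|no_a]; first exact: imset_f.
  by move: jB; rewrite inE => /existsP[a]; rewrite no_a.
move=> i j; rewrite inE => /existsP[a aP] _; rewrite /g.
case: pickP => [b bi|/(_ a)]; last by rewrite aP.
by case: pickP => // b' bj [eb]; apply: part_inj bi _; rewrite eb.
Qed.

(* For a set of selected parts, of union [U]: the surviving crossings form a
   bipartite minor with the selected parts and the basins of the vertices of
   [O :\: U] as nodes. *)
Let survivors_density (S : {set K}) (U := \bigcup_(i in S) P i) :
  (#|[set p in outer | (p.2 \in S) && [disjoint between p & S]]|%:R
   <= minor_density G * (#|S| + #|O :\: U|)%:R)%R.
Proof.
set A := [set p in outer | _].
pose B (j : V + K) := match j with inl v => basin (O :|: U) v | inr i => P i end.
pose J0 := inl @: (O :\: U) :|: inr @: S.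
have J0l v : (inl v \in J0) = (v \in O :\: U).
  rewrite in_setU mem_imset; last exact: inl_inj.
  by rewrite orb_idr // => /imsetP[].
have J0r i : (inr i \in J0) = (i \in S).
  rewrite in_setU orbC mem_imset; last exact: inr_inj.
  by rewrite orb_idr // => /imsetP[].
have cJ0 : #|J0| <= #|S| + #|O :\: U|.
  apply: leq_trans (leq_card_setU _ _) _.
  by rewrite addnC (card_imset _ inl_inj) (card_imset _ inr_inj).
pose h (p : V * K) : (V + K) * (V + K) := (inl p.1, inr p.2).
have h_inj : injective h by case=> v i [w j] [-> ->].
rewrite -(card_imset _ h_inj).
have basinU v y : v \in O :\: U -> y \in basin (O :|: U) v -> y \notin U.
  rewrite !inE => /andP[vU vO] /andP[yG yv]; have [->//|nyv] := eqVneq y v.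
  by have [_ ] := reach_step d_par yv nyv; rewrite inE negb_or => /andP[].
have sub_U i : i \in S -> P i \subset U by move=> iS; apply: bigcup_sup.
apply: le_trans (branch_sets_density (B := B) (J0 := J0) _ _ _) _.
- move=> [v|i]; rewrite ?J0l ?J0r => jJ //=; split.
    by apply/subsetP=> y; rewrite inE => /andP[].
  apply: basin_connected; apply: (subsetP O_vertices).
  by move: jJ; rewrite inE => /andP[].
- move=> [v|i] [w|j]; rewrite ?J0l ?J0r => vJ wJ /= nvw.
  + rewrite -setI_eq0 -subset0; apply/subsetP=> y; rewrite !inE.
    move=> /andP[/andP[_ yv] /andP[_ yw]]; case/eqP: nvw; congr inl.
    move: vJ wJ; rewrite !inE => /andP[_ vO] /andP[_ wO].
    by apply: (reach_inj d_par) yv yw; rewrite inE ?vO ?wO.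
  + rewrite -setI_eq0 -subset0; apply/subsetP=> y; case/setIP=> yv yj.
    by case/negP: (basinU _ _ vJ yv); apply: (subsetP (sub_U j wJ)).
  + rewrite -setI_eq0 -subset0; apply/subsetP=> y; case/setIP=> yj yv.
    by case/negP: (basinU _ _ wJ yv); apply: (subsetP (sub_U i vJ)).
  + by apply: P_disjoint; apply: contraNneq nvw => ->.
- move=> _ /imsetP[p pA ->] /=; rewrite J0l J0r.
  have [pX pS pB] : [/\ p \in outer, p.2 \in S & [disjoint between p & S]].
    by move: pA; rewrite inE => /and3P[].
  have [vO nvP xP xv _] := outerP pX; set x := exit _ _ _ _ _ in xP xv.
  have nxv : x != p.1 by apply: contraNneq nvP => <-.
  have [dx xO pxv] := reach_step d_par xv nxv.
  have xG : x \in vertices G by apply: (subsetP (proj1 (P_connected p.2))).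
  (* A vertex of [U] strictly above [x], up to [p.1] included, would put a selected part in
     [between p]. *)
  have iter_U a : 0 < a <= d x - d p.1 -> iter a par x \notin U.
    case: a => // a lt_a; apply/bigcupP=> -[j jS ajP].
    have: j \in between p by rewrite inE; apply/existsP; exists (Ordinal lt_a).
    by move/(disjointFr pB); rewrite jS.
  have m_gt0 : 0 < d x - d p.1.
    rewrite lt0n; apply: contraNneq nxv => m0.
    by rewrite -[in eqbRHS](reach_iter xv) m0.
  (* The last vertex of the way, [p.1] itself, avoids [U], so it is a node of the minor. *)
  split=> //; first by rewrite inE vO andbT -(reach_iter xv) iter_U ?m_gt0 ?leqnn.
    by apply/imsetP=> -[? _ []].
  (* The tree edge above the exit vertex joins the basin of [p.1] to [P p.2]. *)
  exists (par x), x; split=> //; last by rewrite adj_sym adj_par.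
  rewrite inE par_vertex //=; apply: reach_setU pxv _ => a.
  rewrite d_par -subn1 subnAC subn1 ltn_predRL -iterSr => lt_a.
  by apply: iter_U; apply: ltnW.
apply: ler_wpM2l; last by rewrite ler_nat.
exact: bigmax_ge_id.
Qed.

(** With [3 * D] colours at most a third of the outer crossings fail to survive. Summing
    [survivors_density] over the colours counts every part once and every cut vertex at most [3 * D]
    times; the factor 3/2 lost to the failures, doubled, gives the constants 9 and 3. *)
Lemma crossings_density : 0 < D -> (2%:R / 3%:R <= minor_density G)%R ->
  (2%:R * #|crossings|%:R
   <= minor_density G * (9%:R * D%:R * #|O|%:R + 3%:R * #|K|%:R))%R.
Proof.
move=> D_gt0 density_lb.
pose T := [set t : (V * K) * K | (t.1 \in outer) && (t.2 \in between t.1)].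
have cT : #|T| <= D * #|outer|.
  by rewrite card_dep_pairs mulnC -sum_nat_const; apply: leq_sum => p /card_between.
have [||f] := few_monochromatic (A := T) (a := fun t => t.1.2) (b := snd) (C := 'I_(3 * D)).
- by rewrite card_ord muln_gt0.
- move=> [p j]; rewrite inE /= => /andP[pX jB].
  by have [_ _ _ _] := outerP pX; apply: contraNneq => ->.
rewrite card_ord; set mono := [set t in T | _] => le_mono.
pose S c := [set i | f i == c]; pose U c := \bigcup_(i in S c) P i.
pose A c := [set p in outer | (p.2 \in S c) && [disjoint between p & S c]].
(* A crossing that fails in the colour of its part has some [j] of that colour in [between p], hence
   yields an element of [mono]. *)
have outer_leq : #|outer| <= #|mono| + \sum_c #|A c|.
  pose ok := [set p in outer | [disjoint between p & S (f p.2)]].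
  rewrite -(cardsID ok outer) addnC leq_add //.
    apply: leq_trans (leq_imset_card fst mono); apply/subset_leq_card/subsetP=> p.
    rewrite in_setD => /andP[p_nok pX]; move: p_nok; rewrite in_set pX /=.
    rewrite -setI_eq0 => /set0Pn[j /setIP[jB]]; rewrite in_set => /eqP fj.
    by apply/imsetP; exists (p, j); rewrite // in_set /= fj eqxx in_set pX jB.
  rewrite (card_fibers _ (fun p => f p.2)); apply: leq_sum => c _.
  apply/subset_leq_card/subsetP=> p.
  rewrite in_set in_setI => /andP[/andP[pX]]; rewrite in_set pX /= => pS /eqP fp.
  by rewrite in_set pX -fp pS in_set eqxx.
have sumS : \sum_c #|S c| = #|K|.
  rewrite -cardsT (card_fibers _ f); apply: eq_bigr => c _.
  by apply: eq_card => i; rewrite !inE.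
(* For [v] in [O] and in a part [i], the crossing [(v, i)] never survives; this
   is made up for by [v] not being a node of the minor for the colour of [i]. *)
pose O1 := [set v in O | [exists i, v \in P i]].
have sumO : \sum_c #|O :\: U c| + #|O1| <= 3 * D * #|O|.
  have c0 : 'I_(3 * D) by apply: (@Ordinal _ 0); rewrite muln_gt0.
  (* [c0] is only a default: a vertex of [O1] takes the colour of its part. *)
  pose g v := if [pick i | v \in P i] is Some i then f i else c0.
  have -> : 3 * D * #|O| = \sum_(c < 3 * D) #|O| by rewrite sum_nat_const card_ord.
  rewrite (card_fibers O1 g) -big_split /=.
  apply: leq_sum => c _; rewrite -(cardsID (U c) O) addnC leq_add2r.
  apply/subset_leq_card/subsetP=> v; rewrite in_set in_setI => /andP[].
  rewrite in_set => /andP[-> /existsP[i iv]]; rewrite /g.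
  case: pickP => [j jv /eqP fj|/(_ i)]; last by rewrite iv.
  by apply/bigcupP; exists j; rewrite // in_set fj.
(* A crossing that is not outer is determined by its vertex, which lies in one part only. *)
have cX : #|crossings| <= #|outer| + #|O1|.
  rewrite -(cardsID [set p | p.1 \notin P p.2] crossings) leq_add //.
    by apply: subset_leq_card; apply/subsetP=> p; rewrite !inE.
  rewrite -(card_in_imset (f := fst)).
    apply/subset_leq_card/subsetP=> _ /imsetP[p pX ->].
    move: pX; rewrite in_setD in_set negbK => /andP[vP].
    by rewrite !inE => /andP[-> _]; apply/existsP; exists p.2.
  move=> [v i] [w j]; rewrite !in_setD !in_set !negbK /= => /andP[vi _] /andP[wj _] vw.
  by rewrite -vw in wj *; rewrite (part_inj vi wj).
have sumA : ((\sum_c #|A c|)%:R <= minor_density G * (#|K| + \sum_c #|O :\: U c|)%:R)%R.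
  rewrite -sumS -big_split /= !natr_sum mulr_sumr; apply: ler_sum => c _.
  exact: survivors_density.
have cT' : 3 * #|mono| <= #|outer|.
  by rewrite -(leq_pmul2l D_gt0) mulnA [D * 3]mulnC (leq_trans le_mono).
move: outer_leq sumO cX cT' sumA.
rewrite -!(ler_nat rat) !natrD !natrM => outer_leq sumO cX cT' sumA.
have density_ge0 : (0 <= minor_density G)%R by lra.
have := ler_wpM2l density_ge0 sumO.
(* What remains of [O1] is [(2 - 3 * minor_density G) * #|O1|], nonpositive by the bound [2 / 3]. *)
have /(mulr_ge0 (ler0n rat #|O1|)) : (0 <= minor_density G - 2%:R / 3%:R)%R by lra.
lra.
Qed.

End Crossings.

(** * Blocks, congestion and the counting contradiction *)

Section Shortcuts.

Variables (V : finType) (G : graph V) (r : V) (par : V -> V) (d : V -> nat).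
Variables (D k : nat) (P : 'I_k -> {set V}).

Hypothesis G_nontrivial : 1 < #|vertices G|.
Hypothesis r_vertex : r \in vertices G.
Hypothesis d_root : d r = 0.
Hypothesis d_par : forall x, d (par x) = (d x).-1.
Hypothesis d_leq : {in vertices G, forall x, d x <= D}.
Hypothesis par_vertex : {in vertices G, forall x, par x \in vertices G}.
Hypothesis d_gt0 : {in vertices G, forall x, x != r -> 0 < d x}.
Hypothesis adj_par : {in vertices G, forall x, 0 < d x -> adj G x (par x)}.
Hypothesis P_parts : is_parts G P.

Lemma depth_bound_gt0 : 0 < D.
Proof.
have /card_gt0P[x] : 0 < #|vertices G :\ r|.
  by move: G_nontrivial; rewrite (cardsD1 r) r_vertex.
rewrite in_setD1 => /andP[nxr xG]; exact: leq_trans (d_gt0 xG nxr) (d_leq xG).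
Qed.

(** [G] is a minor of itself, and its non-root vertices have distinct parent edges. *)
Lemma tree_density :
  (#|vertices G|%:R - 1 <= minor_density G * #|vertices G|%:R)%R.
Proof.
have n_gt0 : 0 < #|vertices G| by apply: ltnW.
have le_e : #|vertices G :\ r| <= #|edges G|.
  rewrite -(card_in_imset (f := fun x => [set x; par x])).
    apply/subset_leq_card/subsetP=> _ /imsetP[x /setD1P[nxr xG] ->].
    exact: adj_par (d_gt0 xG nxr).
  move=> x y /setD1P[nxr xG] /setD1P[nyr yG]; apply: (parent_edge_inj d_par); exact: d_gt0.
rewrite -ler_pdivrMr ?ltr0n //.
apply: (@le_trans _ _ (#|edges G|%:R / #|vertices G|%:R)%R).
  rewrite ler_pM2r ?invr_gt0 ?ltr0n // lerBlDr natr1 ler_nat.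
  by rewrite [leqLHS](cardsD1 r) r_vertex add1n ltnS.
apply: (@le_bigmax_cond _ _ _ _ G); rewrite /is_minor connect0 /=.
by rewrite -card_gt0.
Qed.

Local Notation delta := (minor_density G).
Local Notation c := (8%:R * delta * D%:R)%R.

Let c_ge0 : (0 <= c)%R.
Proof. by rewrite !mulr_ge0 // bigmax_ge_id. Qed.

Variable O : {set V}.
Hypothesis in_O : forall v, (v \in O) = (c < #|reaching par d P O v|%:R)%R.

Let reaching_vertex v i : i \in reaching par d P O v -> v \in vertices G.
Proof.
rewrite inE => /exists_inP[x xP /reach_iter <-].
have: x \in vertices G by apply: (subsetP (proj1 (P_parts.1 i))).
by elim: (d x - d v) => [//|a IHa] xG; rewrite iterS par_vertex ?IHa.
Qed.

Let O_vertices : O \subset vertices G.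
Proof.
apply/subsetP=> v; rewrite in_O => /(le_lt_trans c_ge0).
by rewrite ltr0n => /card_gt0P[i /reaching_vertex].
Qed.

Let reaching_par i x : i \in reaching par d P O x -> x \notin O -> 0 < d x ->
  i \in reaching par d P O (par x).
Proof.
rewrite !inE => /exists_inP[y yP xy] xO dx; apply/exists_inP; exists y => //.
exact: reach_par.
Qed.

Definition shortcut (i : 'I_k) : {set {set V}} :=
  [set [set x; par x] | x in vertices G
     & [&& 0 < d x, x \notin O & i \in reaching par d P O x]].

Definition tops (i : 'I_k) : {set V} :=
  [set t in r |: O | i \in reaching par d P O t].

Lemma shortcutP i e : reflect
  (exists x, [/\ x \in vertices G, 0 < d x, x \notin O,
                 i \in reaching par d P O x & e = [set x; par x]])
  (e \in shortcut i).
Proof.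
apply: (iffP imsetP) => [[x]|[x [xG dx xO ix ->]]].
  by rewrite inE => /and4P[xG dx xO ix] ->; exists x.
by exists x; rewrite // inE xG dx xO.
Qed.

(** From any vertex of the block graph, shortcut edges lead up to a cut vertex or the root, which
    [i] still reaches. *)
Lemma shortcut_blocks i :
  num_components (block_graph (P i) (shortcut i)) <= #|tops i|.
Proof.
apply: num_components_leq => x xB.
have {xB} ix : i \in reaching par d P O x.
  move: xB; rewrite in_setU => /orP[xP|/bigcupP[e /shortcutP[y [yG dy yO iy ->]]]].
    by rewrite inE; apply/exists_inP; exists x => //; apply: reach_refl.
  by case/set2P=> -> //; apply: reaching_par.
have [n le_n] := ubnP (d x); elim: n => // n IHn in x ix le_n *.
have xG := reaching_vertex ix.
have [xt|] := boolP (x \in r |: O); first by exists x; rewrite ?connect0 // inE xt.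
rewrite in_setU1 negb_or => /andP[nxr xO]; have dx := d_gt0 xG nxr.
case: (IHn (par x)); [exact: reaching_par | by rewrite d_par -ltnS prednK |].
move=> t tT xt; exists t => //; apply: connect_trans xt; apply: connect1.
by apply/shortcutP; exists x.
Qed.

(** All parts using an edge reach its lower end, which is uncut and hence reached by at most [c]
    parts. *)
Lemma shortcut_congestion (I : {set 'I_k}) e :
  (#|[set i in I | e \in shortcut i]|%:R <= c)%R.
Proof.
have [->|/set0Pn[i /setIdP[_ /shortcutP[x [xG dx xO _ ex]]]]] :=
  eqVneq [set i in I | e \in shortcut i] set0; first by rewrite cards0.
move: (xO); rewrite in_O -leNgt; apply: le_trans; rewrite ler_nat.
apply/subset_leq_card/subsetP=> j /setIdP[_ /shortcutP[y [_ dy _ jy ey]]].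
by rewrite (parent_edge_inj d_par (x := x) (y := y)) // -ex.
Qed.

(** Double counting; the extra [c] pays for the root, which at most [c] parts reach when it is not
    cut. *)
Lemma sum_tops :
  ((\sum_i #|tops i|)%:R <= #|crossings par d P O|%:R + c)%R.
Proof.
have -> : \sum_i #|tops i| = \sum_(t in r |: O) #|reaching par d P O t|.
  under eq_bigr => i _ do rewrite -sum1dep_card big_mkcondr.
  rewrite exchange_big; apply: eq_bigr => t _ /=.
  by rewrite -big_mkcond sum1_card.
have -> : #|crossings par d P O| = \sum_(t in O) #|reaching par d P O t|.
  exact: card_dep_pairs.
have [rO|rO] := boolP (r \in O).
  by rewrite (setUidPr _) ?sub1set // lerDl.
rewrite big_setU1 //= natrD addrC lerD2l.
by move: rO; rewrite in_O -leNgt.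
Qed.

Lemma crossings_lower : (c * #|O|%:R <= #|crossings par d P O|%:R)%R.
Proof.
have -> : #|crossings par d P O| = \sum_(t in O) #|reaching par d P O t|.
  exact: card_dep_pairs.
rewrite natr_sum mulr_natr -sumr_const; apply: ler_sum => v.
by rewrite in_O => /ltW.
Qed.

Lemma many_good_parts :
  k <= 2 * #|[set i | (#|tops i|%:R <= 8%:R * delta)%R]|.
Proof.
set I := [set i | _]; rewrite leqNgt; apply/negP=> lt_k.
have badP i : i \in ~: I -> (8%:R * delta < #|tops i|%:R)%R.
  by rewrite !inE -ltNge.
have card_bad : k < 2 * #|~: I| by have := cardsC I; rewrite card_ord; lia.
have /card_gt0P[i /badP bad_i] : 0 < #|~: I| by lia.
have density_lb := tree_density.
have tops_leq : #|tops i| <= #|O|.+1.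
  apply: (@leq_trans #|r |: O|).
    by apply/subset_leq_card/subsetP=> t /setIdP[].
  by rewrite cardsU1 -add1n leq_add2r leq_b1.
have tops_leq' : #|tops i| <= #|vertices G|.
  by apply/subset_leq_card/subsetP=> t /setIdP[_ /reaching_vertex].
have n_gt0 : (0 < #|vertices G|%:R :> rat)%R by rewrite ltr0n ltnW.
(* For a bad part with [t] tops and [n] vertices in [G], [8 * (n - 1) <= 8 * delta * n < t * n];
   with [t <= n] and [n > 1] this forces [t >= 7]. *)
have tops7 : 6 < #|tops i|.
  have : (8%:R * #|vertices G|%:R < #|tops i|%:R * #|vertices G|%:R + 8%:R :> rat)%R.
    by have := bad_i; rewrite -(ltr_pM2r n_gt0); lra.
  rewrite -!natrM -natrD ltr_nat; move: tops_leq' G_nontrivial.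
  by case: #|tops i| => [|[|[|[|[|[|[|?]]]]]]] //; lia.
(* Since [n >= t >= 7], [tree_density] even gives [6 / 7]. *)
have delta_lb : (2%:R / 3%:R <= delta)%R.
  have : (7%:R <= #|vertices G|%:R :> rat)%R by rewrite ler_nat (leq_trans tops7).
  by rewrite -(ler_pM2r n_gt0); lra.
(* All tops except possibly the root lie in [O]. *)
have O6 : (6%:R <= #|O|%:R :> rat)%R by rewrite ler_nat -ltnS (leq_trans tops7).
have [P_conn P_disj] := P_parts.
have upper : (2%:R * #|crossings par d P O|%:R
   <= delta * (9%:R * D%:R * #|O|%:R + 3%:R * k%:R))%R.
  by rewrite -[in leRHS](card_ord k); apply: crossings_density depth_bound_gt0 _.
have lower := crossings_lower.
have lower' : (8%:R * delta * #|~: I|%:R <= #|crossings par d P O|%:R + c)%R.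
  apply: le_trans sum_tops; rewrite natr_sum mulr_natr -sumr_const.
  rewrite [leRHS](bigID (mem (~: I))) /=; apply: ler_wpDr; first exact: sumr_ge0.
  by apply: ler_sum => j /badP/ltW.
have delta_gt0 : (0 < delta)%R by apply: lt_le_trans delta_lb.
(* Weights 5/4 on [lower] and 3/4 on [lower'] against [upper] leave
   [delta * (D * #|O| - 6 * D + 3) <= 0], contrary to [#|O| >= 6]. *)
have : (0 <= delta * D%:R * (#|O|%:R - 6%:R))%R.
  by rewrite (mulr_ge0 (mulr_ge0 (ltW delta_gt0) (ler0n _ D))) // subr_ge0.
have : (0 <= delta * (2%:R * #|~: I|%:R - (k%:R + 1)))%R.
  by rewrite (mulr_ge0 (ltW delta_gt0)) // subr_ge0 natr1 -natrM ler_nat.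
move: lower lower' upper; lra.
Qed.

End Shortcuts.

(** * Cuts and shortcuts for a given spanning tree *)

Theorem theorem3p1 (V : finType) (G : graph V) (D : nat) (delta : rat)
  (G_simple : simple_graph G) (G_connected : connected_graph G)
  (G_nontrivial : 1 < #|vertices G|)
  (D_def : D = diameter G) (delta_def : delta = minor_density G) :
  admits_partial_shortcuts G D (8%:R * delta * D%:R)%R (8%:R * delta)%R.
Proof.
move=> S r [SG sSG S_connected _] rS depth_S k P P_parts.
have S_edges : {in edges S, forall e : {set V}, e \subset vertices S}.
  move=> e eS; rewrite SG.
  by have /andP[] := forall_inP G_simple e (subsetP sSG e eS).
have [par [d [d_root d_leq d_par par_vertex parP]]] :=
  bfs_parents S_connected rS S_edges.
rewrite SG in rS d_leq par_vertex parP.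
have d_leq' : {in vertices G, forall x, d x <= D}.
  by move=> x /d_leq/leq_trans; apply.
have d_gt0 : {in vertices G, forall x, x != r -> 0 < d x}.
  by move=> x xG /(parP x xG)[].
have adj_par : {in vertices G, forall x, 0 < d x -> adj S x (par x)}.
  move=> x xG dx; have [|//] := parP x xG _.
  by apply: contraTneq dx => ->; rewrite d_root.
have adj_par' : {in vertices G, forall x, 0 < d x -> adj G x (par x)}.
  by move=> x xG dx; apply: (subsetP sSG); apply: adj_par.
have [O in_O] := cut_set d_par P
  (fun X => 8%:R * delta * D%:R < #|X|%:R)%R.
(* The parts kept are those with at most [8 * delta] tops, since tops bound blocks. *)
exists [set i | (#|tops r par d P O i|%:R <= 8%:R * delta)%R].
exists (shortcut G par d P O); rewrite {}delta_def in in_O *; split.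
- exact: (many_good_parts G_nontrivial rS d_root d_par d_leq' par_vertex d_gt0
    adj_par' P_parts in_O).
- move=> i _; apply/subsetP=> e /shortcutP[x [xG dx _ _ ->]]; exact: adj_par.
- move=> e _; exact: (shortcut_congestion d_par in_O).
move=> i; rewrite inE; apply: le_trans; rewrite ler_nat.
exact: (shortcut_blocks d_par par_vertex d_gt0 P_parts).
Qed.
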